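(* Let $1<p<\infty$, $0<s<1$, $i\in\{1,\dots,N\}$ and let $u\in C^2_c(\mathbb{R}^N)$. Then $$\lim_{\delta\to 0^+}\frac{1}{\delta^{p(1-s)}}[u]^i_{s,p,\delta}=\frac{2}{p(1-s)}\|\partial_i u\|_p^p .$$
   Context: For $\delta>0$, $0<s<1$, $1<p<\infty$, a measurable $u:\mathbb{R}^N\to\mathbb{R}$ and the $i$-th canonical vector $e_i$, $$[u]^i_{s,p,\delta}=\int_{\mathbb{R}^N}\int_{|h|\le\delta}\frac{|u(x+he_i)-u(x)|^p}{|h|^{1+sp}}\,dh\,dx ,$$ where $h\in\mathbb{R}$ (note that no $p$-th root is taken). $\|\cdot\|_p$ is the norm of $L^p(\mathbb{R}^N)$. *)

(* Defs.v *)
From HB Require Import structures.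
From mathcomp Require Import all_boot all_order all_algebra.
From mathcomp Require Import all_classical all_reals all_analysis.

Set Implicit Arguments.
Unset Strict Implicit.
Unset Printing Implicit Defensive.

Import Order.TTheory GRing.Theory Num.Theory.
Import numFieldNormedType.Exports.

Local Open Scope classical_set_scope.
Local Open Scope ring_scope.

(* The product sigma-algebra, i.e. the Borel one, generated by the coordinate
   maps (as the library does for [n.-tuple T]). *)
Section measurable_rV.
Context {R : realType} (n : nat).

Let coord : 'I_n -> 'rV[R]_n -> R := fun i v => v 0 i.

Let rV_set0 : g_sigma_preimage coord set0.
Proof. exact: sigma_algebra0. Qed.

Let rV_setC A : g_sigma_preimage coord A -> g_sigma_preimage coord (~` A).
Proof. exact: sigma_algebraC. Qed.

Let rV_bigcup (F : (set 'rV[R]_n)^nat) :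
  (forall i, g_sigma_preimage coord (F i)) ->
  g_sigma_preimage coord (\bigcup_i F i).
Proof. exact: sigma_algebra_bigcup. Qed.

HB.instance Definition _ := @isMeasurable.Build default_measure_display
  'rV[R]_n (g_sigma_preimage coord) rV_set0 rV_setC rV_bigcup.

End measurable_rV.

Section measurable_rV_lemmas.
Context {R : realType}.

Lemma measurable_rV_coord n (i : 'I_n) :
  measurable_fun [set: 'rV[R]_n] (fun v => v 0 i).
Proof.
move=> _ Y mY; rewrite setTI; apply: sub_sigma_algebra => /=.
rewrite -bigcup_seq/=; exists i => /=; first by rewrite mem_index_enum.
by exists Y => //; rewrite setTI.
Qed.

Lemma measurable_fun_rVP d (T : measurableType d) n (f : T -> 'rV[R]_n) :
  measurable_fun [set: T] f <->
  forall i, measurable_fun [set: T] (fun x => f x 0 i).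
Proof.
split=> [mf i|mf].
  exact: (measurableT_comp (measurable_rV_coord i) mf).
have sub : preimage_set_system [set: T] f measurable `<=` measurable.
  pose coord (i : 'I_n) (v : 'rV[R]_n) : R := v 0 i.
  rewrite -[X in X `<=` _](@g_sigma_preimage_comp _ R n 'rV[R]_n coord T f).
  apply: smallest_sub; first exact: sigma_algebra_measurable.
  rewrite -bigcup_seq/=; apply: bigcup_sub => i _ _ [B mB <-].
  exact: mf.
by move=> _ A mA; apply: sub; exists A.
Qed.

Definition rV_cons n (z : R * 'rV[R]_n) : 'rV[R]_n.+1 :=
  row_mx (const_mx z.1 : 'rV[R]_1) z.2.

Lemma rV_cons0 n (z : R * 'rV[R]_n) : rV_cons z 0 ord0 = z.1.
Proof.
have := row_mxEl (const_mx z.1 : 'rV[R]_1) z.2 0 0.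
by rewrite [RHS]mxE => <-; congr (row_mx _ _ _ _); exact/val_inj.
Qed.

Lemma rV_consS n (z : R * 'rV[R]_n) i : rV_cons z 0 (lift ord0 i) = z.2 0 i.
Proof.
have <- := row_mxEr (const_mx z.1 : 'rV[R]_1) z.2 0 i.
by congr (row_mx _ _ _ _); exact/val_inj.
Qed.

Lemma measurable_rV_cons n : measurable_fun [set: R * 'rV[R]_n] (@rV_cons n).
Proof.
apply/measurable_fun_rVP => i; case: (unliftP ord0 i) => [j ->|->].
  under eq_fun do rewrite rV_consS.
  exact: (measurableT_comp (measurable_rV_coord j) measurable_snd).
under eq_fun do rewrite rV_cons0.
exact: measurable_fst.
Qed.

Definition rV_uncons n (v : 'rV[R]_n.+1) : R * 'rV[R]_n :=
  (v 0 ord0, \row_j v 0 (lift ord0 j)).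

Lemma rV_consK n : cancel (@rV_cons n) (@rV_uncons n).
Proof.
move=> [a v]; rewrite /rV_uncons rV_cons0; congr pair.
by apply/rowP => j; rewrite mxE rV_consS.
Qed.

Lemma measurable_rV_uncons n : measurable_fun [set: 'rV[R]_n.+1] (@rV_uncons n).
Proof.
apply: measurable_fun_pair; first exact: measurable_rV_coord.
apply/measurable_fun_rVP => j; under eq_fun do rewrite mxE.
exact: measurable_rV_coord.
Qed.

End measurable_rV_lemmas.

Section rV_cons_measure.
Context {R : realType} (n : nat).
Variable mu : {sigma_finite_measure set 'rV[R]_n -> \bar R}.
Local Open Scope ereal_scope.

Definition rV_cons_measure : set 'rV[R]_n.+1 -> \bar R :=
  pushforward (@lebesgue_measure R \x mu) (@rV_cons R n).

Let rV_cons_measure0 : rV_cons_measure set0 = 0.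
Proof. by rewrite /rV_cons_measure /pushforward preimage_set0 measure0. Qed.

Let rV_cons_measure_ge0 A : 0 <= rV_cons_measure A.
Proof. by rewrite /rV_cons_measure /pushforward measure_ge0. Qed.

Let rV_cons_measure_sigma_additive : semi_sigma_additive rV_cons_measure.
Proof.
move=> F mF tF mUF; rewrite /rV_cons_measure /pushforward preimage_bigcup.
have mpre A : measurable A -> measurable (@rV_cons R n @^-1` A).
  by move=> mA; rewrite -[X in measurable X]setTI; exact: measurable_rV_cons.
apply: measure_semi_sigma_additive; first by move=> k; exact: mpre.
- apply/trivIsetP => /= k l _ _ kl; rewrite -preimage_setI.
  by move/trivIsetP : tF => /(_ _ _ _ _ kl) ->//; rewrite preimage_set0.
- by rewrite -preimage_bigcup; exact: mpre.
Qed.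

HB.instance Definition _ := isMeasure.Build _ _ _ rV_cons_measure
  rV_cons_measure0 rV_cons_measure_ge0 rV_cons_measure_sigma_additive.

Let rV_cons_measure_sigma_finite : sigma_finite setT rV_cons_measure.
Proof.
have /sigma_finiteP[F [FT ndF Foo]] := sigma_finiteT (@lebesgue_measure R).
have /sigma_finiteP[G [GT ndG Goo]] := sigma_finiteT mu.
exists (fun k => @rV_uncons R n @^-1` (F k `*` G k)).
  apply/esym; rewrite -subTset => v _.
  have [k _ Fk] : (\bigcup_k F k) (v 0%R ord0) by rewrite -FT.
  have [l _ Gl] : (\bigcup_k G k) (\row_j v 0%R (lift ord0 j))%R by rewrite -GT.
  exists (maxn k l) => //; split => /=.
  - by move: Fk; exact/subsetPset/ndF/leq_maxl.
  - by move: Gl; exact/subsetPset/ndG/leq_maxr.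
move=> k; have [mF Fk] := Foo k; have [mG Gk] := Goo k.
have mFG : measurable ((F k : set R) `*` G k) by exact: measurableX.
split; first by rewrite -[X in measurable X]setTI; exact: measurable_rV_uncons.
rewrite /rV_cons_measure /pushforward -comp_preimage.
rewrite (_ : _ \o _ = id); last by apply/funext => z; exact: rV_consK.
by rewrite preimage_id product_measure1E// lte_mul_pinfty// ge0_fin_numE.
Qed.

HB.instance Definition _ := Measure_isSigmaFinite.Build _ _ _
  rV_cons_measure rV_cons_measure_sigma_finite.

End rV_cons_measure.

(* Lebesgue measure on R^n: the unit point mass for n = 0, and the product of
   the Lebesgue measures on R and R^n, read on R^(n+1), otherwise. *)
Fixpoint lebesgue_rV {R : realType} (n : nat) :
    {sigma_finite_measure set 'rV[R]_n -> \bar R} :=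
  match n with
  | 0 => @dirac _ 'rV[R]_0 0 R
  | n'.+1 => rV_cons_measure (lebesgue_rV n')
  end.

Lemma lebesgue_rV_box {R : realType} n (A : 'I_n -> set R) :
  (forall i, measurable (A i)) ->
  lebesgue_rV n [set v : 'rV[R]_n | forall i, A i (v 0 i)] =
  (\prod_(i < n) lebesgue_measure (A i))%E.
Proof.
elim: n A => [|n IH] A mA.
  rewrite big_ord0 /= /dirac indicE mem_set//; by case.
rewrite big_ord_recl -(IH (fun i => A (lift ord0 i)))// /=.
rewrite /rV_cons_measure /pushforward.
rewrite (_ : _ @^-1` _ =
  A ord0 `*` [set v : 'rV[R]_n | forall i, A (lift ord0 i) (v 0 i)]); last first.
  apply/seteqP; split => z /=.
    move=> Az; split=> [|i]; first by have := Az ord0; rewrite rV_cons0.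
    by have := Az (lift ord0 i); rewrite rV_consS.
  move=> [A0 AS] i; case: (unliftP ord0 i) => [j ->|->].
    by rewrite rV_consS; exact: AS.
  by rewrite rV_cons0.
apply: product_measure1E; first exact: mA.
rewrite [X in measurable X](_ : _ = \bigcap_(i in [set: 'I_n])
   ((fun v : 'rV[R]_n => v 0 i) @^-1` A (lift ord0 i))).
  apply: fin_bigcap_measurable => [|i _]; first exact: finite_finset.
  by rewrite -[X in measurable X]setTI; exact: measurable_rV_coord.
by apply/seteqP; split => v /= Av i => [_|]; exact: Av.
Qed.

Section calculus.
Context {R : realType} {N : nat}.
Implicit Types (i : 'I_N) (u : 'rV[R]_N -> R).

Definition evec i : 'rV[R]_N := delta_mx 0 i.

Definition partial i u : 'rV[R]_N -> R := 'D_(evec i) u.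

(* All iterated partial derivatives up to order k exist and are continuous. *)
Fixpoint is_Ck (k : nat) u : Prop :=
  match k with
  | 0 => continuous u
  | k'.+1 => continuous u /\
      forall i, (forall x, derivable u x (evec i)) /\ is_Ck k' (partial i u)
  end.

Definition supp u : set 'rV[R]_N := closure [set x | u x != 0].

Definition is_Ckc (k : nat) u : Prop := is_Ck k u /\ compact (supp u).

(* [u]^i_(s,p,delta), without a p-th root. At h = 0, a null set, the integrand is
   0 / 0 = 0. *)
Definition directional_seminorm (s p delta : R) i u : \bar R :=
  (\int[lebesgue_rV N]_x
    \int[lebesgue_measure]_(h in [set h : R | `|h| <= delta]%R)
      (`|u (x + h *: evec i) - u x| `^ p / `|h| `^ (1 + s * p))%:E)%E.

End calculus.

(* Main.v *)
Require Import Defs.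
From mathcomp Require Import all_boot all_order all_algebra.
From mathcomp Require Import all_classical all_reals all_analysis.
From mathcomp Require Import measurable_realfun.
From mathcomp Require Import ring lra.

Set Implicit Arguments.
Unset Strict Implicit.
Unset Printing Implicit Defensive.

Import Order.TTheory GRing.Theory Num.Theory.
Import numFieldNormedType.Exports.

Local Open Scope classical_set_scope.
Local Open Scope ring_scope.

(** Write [v] for the [i]-th partial derivative of [u] and [a = p (1 - s)].
The mean value theorem, applied once to [u] and once to [v] along the
direction [e_i], shows that the difference [u (x + h e_i) - u x] is
[h * v (x + c e_i)] with [|c| <= |h|], and that [v (x + c e_i)] is within
[O(|h|)] of [v x]. Since [t |-> t^p] is Lipschitz on bounded intervals, this gives
[[
  | |u (x + h e_i) - u x|^p - |h|^p |v x|^p | <= |h|^p C |h| 1_K(x)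
]]
for [|h| <= 1], where [K] is a box outside of which both sides vanish
([taylor_powR_estimate]).

Dividing by [|h|^(1 + s p)] leaves the weight [|h|^(a - 1)], whose integral over
[0 < |h| <= delta] is [(2 / a) delta^a] ([integral_norm_powR_punctured]); this is
where the constant of the limit comes from. Integrating first in [h]
([integral_difference_quotient_bounds]) and then in [x] ([integral_squeeze])
encloses the normalized seminorm between
[(2 / a) (I - C delta m)] and [(2 / a) (I + C delta m)], where [I] is the
integral of [|v|^p] and [m] the finite measure of [K]. Both bounds tend to
[(2 / a) I].

The difference quotient and its inner integral are bracketed by explicit
functions, and the integrals are then compared by
[ge0_le_integral_nonmeasurable]; the only functions of [x] that have to be
measurable are [|v|^p], which is continuous, and the indicator of [K]. *)

(** * Monotonicity of the integral *)

(** The integral of a nonnegative function is by definition a supremum over the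
simple functions below it, and this family of simple functions grows with the
function. *)
Lemma ge0_le_integral_nonmeasurable d (T : measurableType d) (R : realType)
    (mu : {measure set T -> \bar R}) (D : set T) (f g : T -> \bar R) :
  (forall x, D x -> 0 <= f x)%E -> (forall x, D x -> f x <= g x)%E ->
  (\int[mu]_(x in D) f x <= \int[mu]_(x in D) g x)%E.
Proof.
move=> f0 fg.
have g0 x : D x -> (0 <= g x)%E by move=> Dx; exact: le_trans (f0 x Dx) (fg x Dx).
rewrite !ge0_integralE//; apply: ereal_sup_le => _ [h hf <-]; exists h => // x.
apply: le_trans (hf x) _; rewrite !patchE; case: ifPn => // /set_mem Dx.
exact: fg.
Qed.

(** * The singular weight on the line *)

Section radial.
Context {R : realType}.
Let mu := @lebesgue_measure R.

Lemma integral_powR_itv (a e d : R) : 0 < a -> 0 < e -> e < d ->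
  (\int[mu]_(h in `[e, d]) (h `^ (a - 1))%:E = (a^-1 * (d `^ a - e `^ a))%:E)%E.
Proof.
move=> a0 e0 ed.
have dF (x : R) : 0 < x -> is_derive x 1 (fun h : R => a^-1 * h `^ a) (x `^ (a - 1)).
  move=> x0; have H := is_derive1_powR a x0.
  have -> : x `^ (a - 1) = a^-1 *: (a * x `^ (a - 1)).
    by rewrite [RHS]mulKf// gt_eqF.
  exact: is_deriveZ.
have cF b (x : R) : 0 < x -> {for x, continuous (fun h : R => h `^ b)}.
  move=> x0; apply/differentiable_continuous/derivable1_diffP.
  by case: (is_derive1_powR b x0).
have cG (x : R) : 0 < x -> {for x, continuous (fun h : R => a^-1 * h `^ a)}.
  move=> x0; apply/differentiable_continuous/derivable1_diffP.
  by case: (dF x x0).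
rewrite (@continuous_FTC2 _ (fun h => h `^ (a - 1)) (fun h => a^-1 * h `^ a))//.
- by rewrite -EFinB -mulrBr.
- apply: continuous_in_subspaceT => x /set_mem/=; rewrite in_itv/= => /andP[ex _].
  by apply: cF; exact: lt_le_trans ex.
- split.
  + move=> x; rewrite in_itv/= => /andP[ex _].
    by case: (dF x (lt_trans e0 ex)).
  + by apply: cvg_at_right_filter; exact: cG.
  + by apply: cvg_at_left_filter; apply: cG; exact: lt_trans ed.
- move=> x; rewrite in_itv/= => /andP[ex _].
  by rewrite derive1E; have H := dF x (lt_trans e0 ex); rewrite derive_val.
Qed.

Lemma measurable_norm_powR (b : R) (D : set R) :
  measurable_fun D (EFin \o (fun h : R => `|h| `^ b)).
Proof.
apply/measurable_EFinP/measurable_funTS.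
exact: (measurableT_comp (measurable_powR b)).
Qed.

(** For [a < 1] the weight is unbounded at the origin, out of reach of the
fundamental theorem of calculus; on an annulus it is continuous, and the two
halves are exchanged by [h |-> - h]. *)
Lemma integral_norm_powR_annulus (a e d : R) : 0 < a -> 0 < e -> e < d ->
  (\int[mu]_(h in [set h | e <= `|h| <= d]%R) (`|h| `^ (a - 1))%:E
   = (2 / a * (d `^ a - e `^ a))%:E)%E.
Proof.
move=> a0 e0 ed.
have -> : [set h | e <= `|h| <= d] = `[e, d] `|` `[(- d)%R, (- e)%R] :> set R.
  apply/seteqP; split => h /=; rewrite !in_itv/=.
    move=> /andP[]; have [h0|h0] := leP 0 h.
      by rewrite ger0_norm// => -> ->; left.
    by rewrite ltr0_norm// => eh hd; right; rewrite lerNl hd lerNr.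
  move=> [/andP[eh hd]|/andP[dh he]].
    by rewrite ger0_norm ?eh//; exact: le_trans (ltW e0) eh.
  have h0 : h < 0 by rewrite (le_lt_trans he)// oppr_lt0.
  by rewrite ltr0_norm// lerNr he lerNl.
rewrite ge0_integral_setU//=; last 2 first.
- exact: measurable_norm_powR.
- rewrite disj_set2E; apply/eqP/seteqP; split => // h [] /=; rewrite !in_itv/=.
  move=> /andP[eh _] /andP[_ he]; have := le_trans eh he.
  by rewrite leNgt (lt_trans _ e0)// oppr_lt0.
have E : (\int[mu]_(h in `[e, d]) (`|h| `^ (a - 1))%:E =
    (a^-1 * (d `^ a - e `^ a))%:E)%E.
  rewrite -integral_powR_itv//; apply: eq_integral => h.
  rewrite inE/= in_itv/= => /andP[eh _].
  by rewrite ger0_norm// (le_trans (ltW e0)).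
rewrite integration_by_substitution_oppr//; last 2 first.
- exact: ltW.
- apply: continuous_in_subspaceT => x /set_mem/=; rewrite in_itv/= => /andP[_ xe].
  have x0 : x < 0 by rewrite (le_lt_trans xe)// oppr_lt0.
  apply: (@continuous_comp _ _ _ (fun h : R => `|h|) (fun h => h `^ (a - 1))).
    exact: norm_continuous.
  apply/differentiable_continuous/derivable1_diffP.
  have H : 0 < `|x| by rewrite normr_gt0 lt_eqF.
  by case: (is_derive1_powR (a - 1) H).
under [X in (_ + X)%E]eq_integral do rewrite /= normrN.
by rewrite E -EFinD -mulr2n -mulrnAl mulr_natl.
Qed.

(** Monotone convergence over the annuli [d / (n + 2) <= |h| <= d], which exhaust
the punctured interval; the inner boundary term tends to [0] because [0 < a]. *)
Lemma integral_norm_powR_punctured (a d : R) : 0 < a -> 0 < d ->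
  (\int[mu]_(h in [set h | 0 < `|h| <= d]%R) (`|h| `^ (a - 1))%:E
   = (2 / a * d `^ a)%:E)%E.
Proof.
move=> a0 d0.
pose F n : set R := [set h | d / n.+2%:R <= `|h| <= d].
have -> : [set h : R | 0 < `|h| <= d] = \bigcup_n F n.
  apply/seteqP; split => h /=.
    move=> /andP[h0 hd]; exists (Num.truncn (d / `|h|)) => //=.
    rewrite /F/= hd andbT ler_pdivrMr// mulrC -ler_pdivrMr//.
    apply/ltW/(lt_trans (truncnS_gt _)).
    by rewrite ltr_nat.
  by move=> [n _] /andP[nh hd]; rewrite hd (lt_le_trans _ nh)// divr_gt0.
have ndF : nondecreasing_seq F.
  move=> m n mn; apply/subsetPset => h; rewrite /F/= => /andP[mh ->]; rewrite andbT.
  apply: le_trans mh; rewrite ler_pM2l// lef_pV2 ?posrE//.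
  by rewrite ler_nat !ltnS.
have mF n : measurable (F n).
  rewrite /F (_ : mkset _ = (fun h : R => `|h|) @^-1` `[d / n.+2%:R, d]).
    by rewrite -[X in measurable X]setTI; exact: normr_measurable.
  by apply/seteqP; split => h /=; rewrite in_itv.
have Fcvg : (\int[mu]_(h in F n) (`|h| `^ (a - 1))%:E @[n --> \oo] -->
    \int[mu]_(h in \bigcup_n F n) (`|h| `^ (a - 1))%:E)%E.
  apply: ge0_nondecreasing_set_cvg_integral => // n.
  exact: measurable_norm_powR.
have e0 : d / n.+2%:R @[n --> \oo] --> (0 : R).
  rewrite -(mulr0 d); apply: cvgMl_tmp.
  by have := @cvg_harmonic R; rewrite -cvg_shiftS; exact.
have ea0 : (d / n.+2%:R) `^ a @[n --> \oo] --> (0 : R).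
  have /cvg_at_rightP := powR_cvg0 a0; apply; split => // n.
  by rewrite divr_gt0.
have Flim : (\int[mu]_(h in F n) (`|h| `^ (a - 1))%:E @[n --> \oo] -->
    (2 / a * d `^ a)%:E)%E.
  under eq_cvg => n.
    rewrite integral_norm_powR_annulus//; first over.
      by rewrite divr_gt0.
    by rewrite gtr_pMr// invf_lt1// ltr1n.
  have Rlim : 2 / a * (d `^ a - (d / n.+2%:R) `^ a) @[n --> \oo] -->
      2 / a * d `^ a.
    have : 2 / a * (d `^ a - (d / n.+2%:R) `^ a) @[n --> \oo] -->
        2 / a * (d `^ a - 0).
      by apply: cvgMl_tmp; exact: (cvgB (cvg_cst _) ea0).
    by rewrite subr0.
  by apply: cvg_EFin; [exact: nearW|exact: Rlim].
by rewrite -(cvg_lim (@ereal_hausdorff R) Fcvg) (cvg_lim _ Flim).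
Qed.

End radial.

Lemma integral_scaled_norm_powR (R : realType) (a d B : R) :
  0 < a -> 0 < d -> 0 <= B ->
  (\int[lebesgue_measure]_(h in [set h : R | 0 < `|h| <= d]%R)
     (B * `|h| `^ (a - 1))%:E = (B * (2 / a * d `^ a))%:E)%E.
Proof.
move=> a0 d0 B0; under eq_integral do rewrite EFinM.
rewrite ge0_integralZl_EFin//.
- by rewrite integral_norm_powR_punctured.
- rewrite [X in measurable X](_ : _ = (fun h : R => `|h|) @^-1` `]0, d]).
    by rewrite -[X in measurable X]setTI; exact: normr_measurable.
  by apply/seteqP; split => h /=; rewrite in_itv.
- exact: measurable_norm_powR.
Qed.

(** * Continuous functions of several variables are measurable *)

Section measurable_continuous.
Context {R : realType} {n : nat}.

Lemma measurable_rV_forall (A : 'I_n -> set R) : (forall j, measurable (A j)) ->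
  measurable [set v : 'rV[R]_n | forall j, A j (v 0 j)].
Proof.
move=> mA; rewrite [X in measurable X](_ : _ = \bigcap_(j in [set: 'I_n])
   ((fun v : 'rV[R]_n => v 0 j) @^-1` A j)).
  apply: fin_bigcap_measurable => [|j _]; first exact: finite_finset.
  by rewrite -[X in measurable X]setTI; exact: measurable_rV_coord.
by apply/seteqP; split => v /= Av j => [_|]; exact: Av.
Qed.

(** The sigma-algebra is generated by the coordinates, so that openness has to be
related to it: an open set is the union of the sup-norm balls with rational centre
and radius [1 / (k + 1)] that it contains, and these are countably many. *)
Lemma open_measurable_rV (U : set 'rV[R]_n) : open U -> measurable U.
Proof.
move=> oU.
pose box (z : 'rV[rat]_n * nat) : set 'rV[R]_n :=
  [set v | forall j, ball (ratr (z.1 0 j) : R) (z.2.+1%:R^-1) (v 0 j)].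
(* The boxes that stick out of [U] are replaced by the empty set, which keeps the
   index set of the union a countable type. *)
pose F z := if `[< box z `<=` U >] then box z else set0.
have -> : U = \bigcup_z F z.
  apply/seteqP; split => [x Ux|x [z _]]; last first.
    by rewrite /F; case: asboolP => // zU; exact: zU.
  have /nbhs_ballP[e /= e0 eU] : nbhs x U by apply: open_nbhs_nbhs; split.
  pose k := Num.truncn (2 / e).
  have ke : k.+1%:R^-1 < e / 2 :> R.
    by rewrite -[e / 2]invf_div ltf_pV2 ?posrE ?divr_gt0// truncnS_gt.
  have k0 : 0 < k.+1%:R^-1 :> R by rewrite invr_gt0.
  have qP j : exists q : rat, ball (ratr q : R) k.+1%:R^-1 (x 0 j).
    have : x 0 j - k.+1%:R^-1 < x 0 j + k.+1%:R^-1.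
      by rewrite ltrD2l (lt_trans _ k0)// oppr_lt0.
    move=> /rat_in_itvoo[q]; rewrite in_itv/= => /andP[q1 q2]; exists q.
    by rewrite /ball/= ltr_distl q1 q2.
  have [q qx] := choice qP.
  exists (\row_j q j, k) => //; rewrite /F; case: asboolP => [_ j|[]] /=.
    by rewrite mxE.
  move=> y yq; apply: eU; split => // i j; rewrite ord1.
  have /= := yq j; rewrite mxE => qy.
  apply: (@le_ball _ _ _ (k.+1%:R^-1 + k.+1%:R^-1)).
    by rewrite [leRHS]splitr lerD// ltW.
  exact: ball_triangle (ball_sym (qx j)) qy.
apply: countable_bigcupT_measurable => [|z]; first exact: countableP.
rewrite /F; case: asboolP => // _.
apply: (@measurable_rV_forall (fun j => ball (ratr (z.1 0 j) : R) _)) => j.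
exact: measurable_ball.
Qed.

Lemma continuous_measurable_rV (f : 'rV[R]_n -> R) :
  continuous f -> measurable_fun [set: 'rV[R]_n] f.
Proof.
move=> /continuousP cf.
apply: (measurability _ (RGenOpens.measurableE R)).
move=> _ [_ [a [b ->] <-]]; rewrite setTI.
by apply: open_measurable_rV; apply: cf; exact: interval_open.
Qed.

End measurable_continuous.

(** * The power function and derivatives along a line *)

(** The graph of the convex function [t |-> t^p] lies above its tangent at [x].
At [y = 0] this reduces to [1 <= p]; for [0 < y] it is the mean value theorem and
the monotonicity of [t^(p - 1)]. *)
Lemma powR_tangent_le (R : realType) (p x y : R) : 1 <= p -> 0 <= y <= x ->
  x `^ p - y `^ p <= p * x `^ (p - 1) * (x - y).
Proof.
move=> p1 /andP[]; have p0 : 0 < p by exact: lt_le_trans p1.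
rewrite le_eqVlt => /predU1P[<- x0|y0 yx].
  rewrite powR0 ?gt_eqF// !subr0 -mulrA [_ * x]mulrC mulr_powRB1//.
  by rewrite ler_peMl// powR_ge0.
have D z : z \in `]y, x[ -> is_derive z 1 (fun t : R => t `^ p) (p * z `^ (p - 1)).
  by rewrite in_itv/= => /andP[yz _]; apply: is_derive1_powR; exact: lt_trans yz.
have [|c] := @MVT_segment _ (fun t : R => t `^ p) _ y x yx D.
  apply: derivable_within_continuous => z; rewrite in_itv/= => /andP[yz _].
  by apply: derivable_powR; rewrite in_itv/= andbT (lt_le_trans y0).
rewrite in_itv/= => /andP[yc cx] ->.
rewrite ler_wpM2r ?subr_ge0// ler_wpM2l ?(ltW p0)//.
rewrite ge0_ler_powR ?subr_ge0// nnegrE; first by rewrite (le_trans (ltW y0)).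
by rewrite (le_trans (ltW y0)).
Qed.

Lemma powR_lipschitz (R : realType) (p M x y : R) : 1 <= p ->
  0 <= x <= M -> 0 <= y <= M ->
  `|x `^ p - y `^ p| <= p * M `^ (p - 1) * `|x - y|.
Proof.
move=> p1; have p0 : 0 <= p by exact: le_trans p1.
wlog yx : x y / y <= x => [hwlog|/andP[x0 xM] /andP[y0 yM]].
  move=> xM yM; have [yx|/ltW xy] := leP y x; first exact: hwlog.
  by rewrite distrC [`|x - y|]distrC hwlog.
rewrite !ger0_norm ?subr_ge0//; last by rewrite ge0_ler_powR.
apply: le_trans (powR_tangent_le p1 _) _; first by rewrite y0.
rewrite ler_wpM2r ?subr_ge0// ler_wpM2l//.
by rewrite ge0_ler_powR ?subr_ge0// nnegrE (le_trans x0).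
Qed.

Section directional_calculus.
Context {R : realType} {N : nat}.
Implicit Types (f : 'rV[R]_N -> R) (e x : 'rV[R]_N).

(** Restricting [f] to a line reduces directional derivatives to derivatives on
the real line, where the mean value theorem lives. *)
Lemma is_derive_line f e x (t : R) : derivable f (x + t *: e) e ->
  is_derive t 1 (fun s => f (x + s *: e)) ('D_e f (x + t *: e)).
Proof.
move=> df.
have E : (fun h => h^-1 *: (((fun s => f (x + s *: e)) \o shift t) (h *: 1) -
     f (x + t *: e))) =
   (fun h : R => h^-1 *: ((f \o shift (x + t *: e)) (h *: e) - f (x + t *: e))).
  apply/funext => h /=; congr (_ *: (f _ - _)).
  by rewrite [h *: 1]mulr1 scalerDl addrCA.
by split; rewrite /derivable /derive E.
Qed.

(** Only the bound [|c| <= |h|] is kept on the intermediate point, so that both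
signs of [h] are covered. *)
Lemma MVT_line f e x (h : R) : (forall y, derivable f y e) ->
  exists2 c : R, `|c| <= `|h| & f (x + h *: e) - f x = h * 'D_e f (x + c *: e).
Proof.
move=> df.
have D t := is_derive_line (df (x + t *: e)).
have C (I : interval R) : {within [set` I], continuous (fun s => f (x + s *: e))}.
  by apply: derivable_within_continuous => t _; case: (D t).
have f0 : f x = f (x + 0 *: e) by rewrite scale0r addr0.
have [h0|h0] := leP 0 h.
  have [c] := MVT_segment h0 (fun t _ => D t) (C _).
  rewrite in_itv/= => /andP[c0 ch] E; exists c; first by rewrite !ger0_norm.
  by rewrite f0 E subr0 mulrC.
have [c] := MVT_segment (ltW h0) (fun t _ => D t) (C _).
rewrite in_itv/= => /andP[hc c0] E; exists c.
  by rewrite ler0_norm// ltr0_norm// lerN2.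
by rewrite f0 -opprB E sub0r mulrN opprK mulrC.
Qed.

Lemma supp0 f x : ~ supp f x -> f x = 0.
Proof.
move=> xf; apply/eqP/negPn/negP => fx; apply: xf; exact: subset_closure.
Qed.

(** Stated for a closed set [K] rather than the support of [f], so that it can be
iterated: the second derivatives vanish off the support of the function. *)
Lemma partial_eq0_off_closed i f (K : set 'rV[R]_N) : closed K ->
  (forall x, ~ K x -> f x = 0) -> forall x, ~ K x -> partial i f x = 0.
Proof.
move=> cK f0 x Kx; rewrite /partial (@near_eq_derive R _ _ f (cst 0)).
  by rewrite derive_cst.
have : nbhs x (~` K) by apply: open_nbhs_nbhs; split => //; exact/closed_openC.
by apply: filterS => y; exact: f0.
Qed.

Lemma bounded_compact_support f (K : set 'rV[R]_N) : continuous f -> compact K ->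
  (forall x, ~ K x -> f x = 0) -> exists2 M : R, 0 <= M & forall x, `|f x| <= M.
Proof.
move=> cf cK f0.
have /compact_bounded[M [_ MK]] : compact (f @` K).
  by apply: continuous_compact => //; exact: continuous_subspaceT.
exists (`|M| + 1) => [|x]; first by rewrite addr_ge0.
have [Kx|/f0->] := pselect (K x); last by rewrite normr0 addr_ge0.
apply: (MK (`|M| + 1)); last by exists x.
by rewrite (le_lt_trans (ler_norm _))// ltrDl.
Qed.

Lemma norm_coord_le (x : 'rV[R]_N) j : `|x 0 j| <= `|x|.
Proof.
rewrite [leRHS]mx_normrE.
exact: (le_bigmax _ (fun ij : 'I_1 * 'I_N => `|x ij.1 ij.2|) (0, j)).
Qed.

End directional_calculus.

(** * Pointwise expansion of the difference quotient *)

(** The box [K] is the support of [u] enlarged by [1] in the sup norm, so that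
[x] outside [K] and [|h| <= 1] keep the whole segment outside the support. The
bound of [|partial i u|^p] by a multiple of the indicator of [K] is what makes the
limit finite. *)
Lemma taylor_powR_estimate (R : realType) (N : nat) (p : R) (i : 'I_N)
    (u : 'rV[R]_N -> R) : 1 <= p -> is_Ckc 2 u ->
  exists (K : set 'rV[R]_N) (C : R), [/\ measurable K,
    (lebesgue_rV N K < +oo)%E, 0 <= C,
    forall x, `|partial i u x| `^ p <= C * \1_K x &
    forall x h, `|h| <= 1 ->
      `| `|u (x + h *: evec i) - u x| `^ p - `|h| `^ p * `|partial i u x| `^ p |
      <= `|h| `^ p * (C * `|h| * \1_K x)].
Proof.
move=> p1 [[_ /(_ i)[du [cv /(_ i)[dv cw]]]] csupp].
set v := partial i u in cv dv cw *; set w := partial i v in cw.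
have clsupp : closed (supp u) by exact: closed_closure.
have v0 : forall x, ~ supp u x -> v x = 0.
  by apply: partial_eq0_off_closed => // x; exact: supp0.
have w0 : forall x, ~ supp u x -> w x = 0 by exact: partial_eq0_off_closed.
have [M1 M10 vM] := bounded_compact_support cv csupp v0.
have [M2 M20 wM] := bounded_compact_support cw csupp w0.
have [A [_ /(_ (`|A| + 1))uA]] := compact_bounded csupp.
have {}uA x : supp u x -> `|x| <= `|A| + 1.
  by apply: uA; rewrite (le_lt_trans (ler_norm _))// ltrDl.
pose r := `|A| + 1 + 1.
have r0 : 0 < r by rewrite ltr_wpDl.
pose K := [set x : 'rV[R]_N | forall j, (`[- r, r]%classic : set R) (x 0 j)].
have off x (h : R) : ~ K x -> `|h| <= 1 -> ~ supp u (x + h *: evec i).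
  move=> Kx h1 /uA xh; apply: Kx => j /=; rewrite in_itv/= -ler_norml.
  have -> : x 0 j = (x + h *: evec i) 0 j - h * evec i 0 j.
    by rewrite !mxE addrK.
  rewrite (le_trans (ler_normB _ _))// lerD//.
    exact: le_trans (norm_coord_le _ j) xh.
  rewrite normrM mxE normr_nat -[leRHS]mulr1 ler_pM//.
  by case: (_ && _).
have off0 x : ~ K x -> ~ supp u x.
  by move=> Kx; have := @off x 0 Kx; rewrite normr0 scale0r addr0; exact.
have C10 : 0 <= p * M1 `^ (p - 1) * M2.
  by rewrite !mulr_ge0 ?powR_ge0// (le_trans _ p1).
(* The first summand is the Lipschitz constant of the power function for
   [0 <= t <= M1] times a bound of the second derivative; the second summand bounds
   the power of the first derivative. *)
exists K, (p * M1 `^ (p - 1) * M2 + M1 `^ p); split.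
- by apply: (@measurable_rV_forall _ _ (fun=> `[- r, r]%classic)) => j.
- rewrite (lebesgue_rV_box (A := fun=> `[- r, r]%classic))//.
  under eq_bigr do rewrite lebesgue_measure_itv/=.
  rewrite (eq_bigr (fun=> (r - - r)%:E)); first by rewrite prodEFin ltry.
  move=> _ _; rewrite ifT// lte_fin -subr_gt0 opprK addr_gt0//.
- by rewrite addr_ge0 ?powR_ge0.
- move=> x; have [Kx|Kx] := pselect (K x).
    rewrite indicE mem_set// mulr1 ler_wpDl//.
    by rewrite ge0_ler_powR ?nnegrE// (le_trans _ p1).
  rewrite indicE memNset// mulr0 v0; last exact: off0.
  by rewrite normr0 powR0 // gt_eqF // (lt_le_trans _ p1).
- move=> x h h1; have p0 : p != 0 by rewrite gt_eqF// (lt_le_trans _ p1).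
  have [Kx|Kx] := pselect (K x); last first.
    rewrite (supp0 (off _ _ Kx h1)) (supp0 (off0 _ Kx)) (v0 _ (off0 _ Kx)).
    by rewrite subrr normr0 powR0// mulr0 subrr normr0 indicE memNset// !mulr0.
  rewrite indicE mem_set// mulr1.
  have [c ch ->] := @MVT_line _ _ u (evec i) x h du.
  rewrite -/(partial i u (x + c *: evec i)) -/v normrM powRM// -mulrBr normrM.
  rewrite ger0_norm ?powR_ge0// ler_wpM2l ?powR_ge0//.
  apply: le_trans (powR_lipschitz p1 (M := M1) _ _) _; [by rewrite normr_ge0 vM..|].
  have {ch} vv : `|v (x + c *: evec i) - v x| <= `|h| * M2.
    have [c' _ ->] := @MVT_line _ _ v (evec i) x c dv.
    by rewrite normrM ler_pM// wM.
  apply: (@le_trans _ _ (p * M1 `^ (p - 1) * (`|h| * M2))).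
    rewrite ler_wpM2l ?mulr_ge0 ?powR_ge0 ?(le_trans _ p1)//.
    exact: le_trans (ler_dist_dist _ _) vv.
  rewrite [`|h| * M2]mulrC mulrA ler_wpM2r//.
  by rewrite lerDl powR_ge0.
Qed.

(** * Integral estimates and the limit *)

(** The estimate in [h] at a fixed point [x]: [f h] stands for
[u (x + h e_i) - u x], [b] for [|v x|^p] and [c] for the error. The lower bound is
truncated at [0] because the comparison of integrals is between nonnegative
functions. *)
Lemma integral_difference_quotient_bounds (R : realType) (p s d b c : R)
    (f : R -> R) :
  1 < p -> s < 1 -> 0 < d -> 0 <= b -> 0 <= c -> f 0 = 0 ->
  (forall h, `|h| <= d ->
    `| `|f h| `^ p - `|h| `^ p * b | <= `|h| `^ p * c) ->
  ((2 / (p * (1 - s)) * d `^ (p * (1 - s)) * Num.max 0 (b - c))%:E <=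
    \int[lebesgue_measure]_(h in [set h : R | `|h| <= d]%R)
      (`|f h| `^ p / `|h| `^ (1 + s * p))%:E <=
    (2 / (p * (1 - s)) * d `^ (p * (1 - s)) * (b + c))%:E)%E.
Proof.
move=> p1 s1 d0 b0 c0 f0 fbc.
set k := _ / _ * _ `^ _; set J := (\int[_]_(h in _) _)%E.
have p0 : 0 < p by exact: lt_trans p1.
set a := p * (1 - s) in k *.
have a0 : 0 < a by rewrite mulr_gt0// subr_gt0.
have -> : J = (\int[lebesgue_measure]_(h in [set h : R | 0 < `|h| <= d]%R)
      (`|f h| `^ p / `|h| `^ (1 + s * p))%:E)%E.
  (* The origin can be removed because the quotient is [0] there, unlike the
     weight [|h|^(a - 1)], which is [1] at the origin if [a = 1]. *)
  rewrite /J integral_mkcond [RHS]integral_mkcond; apply: eq_integral => h _.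
  rewrite !patchE; have [->|h0] := eqVneq h 0.
    by rewrite f0 normr0 powR0 ?gt_eqF// mul0r !if_same.
  by congr (if _ then _ else _); apply/idP/idP; rewrite !inE/= normr_gt0 h0.
have kE (h : R) : 0 < `|h| -> `|h| `^ p / `|h| `^ (1 + s * p) = `|h| `^ (a - 1).
  move=> h0; rewrite -powRB; last by rewrite (gt_eqF h0) implybT.
  by congr (_ `^ _); rewrite /a; ring.
apply/andP; split.
  rewrite [k * _]mulrC -integral_scaled_norm_powR//; last by rewrite le_max lexx.
  apply: ge0_le_integral_nonmeasurable => h /andP[h0 hd].
    by rewrite lee_fin mulr_ge0 ?powR_ge0// le_max lexx.
  rewrite lee_fin -kE// mulrA ler_wpM2r ?invr_ge0 ?powR_ge0//.
  rewrite maxr_pMl ?powR_ge0// mul0r ge_max powR_ge0/=.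
  by have := fbc h hd; rewrite ler_norml => /andP[+ _]; lra.
rewrite [k * _]mulrC -integral_scaled_norm_powR//; last by rewrite addr_ge0.
apply: ge0_le_integral_nonmeasurable => h /andP[h0 hd].
  by rewrite lee_fin divr_ge0 ?powR_ge0.
rewrite lee_fin -kE// mulrA ler_wpM2r ?invr_ge0 ?powR_ge0//.
by have := fbc h hd; rewrite ler_norml => /andP[_]; lra.
Qed.

Lemma ge0_integralDindic d (T : measurableType d) (R : realType)
    (mu : {measure set T -> \bar R}) (K : set T) (g : T -> R) (c : R) :
  measurable K -> (forall x, 0 <= g x) -> 0 <= c -> measurable_fun setT g ->
  (\int[mu]_x (g x + c * \1_K x)%:E = \int[mu]_x (g x)%:E + c%:E * mu K)%E.
Proof.
move=> mK g0 c0 mg; under eq_integral do rewrite EFinD EFinM.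
rewrite ge0_integralD//.
- rewrite ge0_integralZl_EFin//; first by rewrite integral_indic// setIT.
  exact/measurable_EFinP.
- by move=> x _; rewrite lee_fin.
- exact/measurable_EFinP.
- by move=> x _; rewrite -EFinM lee_fin mulr_ge0.
- by apply/measurable_EFinP; apply: measurable_funM.
Qed.

(** The estimate in [x]. As [J] need not be measurable, additivity of the
integral is not available for it: the lower bound goes through
[g <= max(0, g - c 1_K) + c 1_K], where both terms on the right are measurable. *)
Lemma integral_squeeze d (T : measurableType d) (R : realType)
    (mu : {measure set T -> \bar R}) (K : set T) (g : T -> R) (J : T -> \bar R)
    (c k r m : R) :
  measurable K -> (forall x, 0 <= g x) -> 0 <= c -> 0 <= k ->
  measurable_fun setT g ->
  (\int[mu]_x (g x)%:E = r%:E)%E -> mu K = m%:E ->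
  (forall x, ((k * Num.max 0 (g x - c * \1_K x))%:E <= J x
    <= (k * (g x + c * \1_K x))%:E)%E) ->
  ((k * (r - c * m))%:E <= \int[mu]_x J x <= (k * (r + c * m))%:E)%E.
Proof.
move=> mK g0 c0 k0 mg gr Km gJ.
have mx x : 0 <= Num.max 0 (g x - c * \1_K x) by rewrite le_max lexx.
have J0 x : (0 <= J x)%E.
  have /andP[+ _] := gJ x; apply: le_trans.
  by rewrite lee_fin mulr_ge0.
have mI : measurable_fun setT (fun x => c * \1_K x : R).
  exact: measurable_funM.
have mm : measurable_fun setT (fun x => Num.max 0 (g x - c * \1_K x)).
  by apply: measurable_maxr => //; exact: measurable_funB.
apply/andP; split.
  set h := fun x => Num.max 0 (g x - c * \1_K x) in mx mm gJ.
  have : (k%:E * r%:E <= \int[mu]_x J x + (k * (c * m))%:E)%E.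
    rewrite -gr.
    apply: (@le_trans _ _ (k%:E * \int[mu]_x (h x + c * \1_K x)%:E)%E).
      apply: lee_wpmul2l => //; apply: ge0_le_integral_nonmeasurable => x _.
        by rewrite lee_fin.
      by rewrite lee_fin -lerBlDr /h le_max lexx orbT.
    rewrite ge0_integralDindic// Km ge0_muleDr; last 2 first.
    - by apply: integral_ge0 => x _; rewrite lee_fin; exact: mx.
    - by rewrite -Km mule_ge0.
    rewrite -!EFinM leeD2r// -ge0_integralZl_EFin//; last 2 first.
    - by move=> x _; rewrite lee_fin; exact: mx.
    - exact/measurable_EFinP.
    apply: ge0_le_integral_nonmeasurable => x _.
      by rewrite -EFinM lee_fin mulr_ge0//; exact: mx.
    by have /andP[] := gJ x.
  by rewrite -EFinM -leeBlDr// -EFinB mulrBr.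
apply: (@le_trans _ _ (\int[mu]_x (k%:E * (g x + c * \1_K x)%:E))%E).
  apply: ge0_le_integral_nonmeasurable => x _ //.
  by have /andP[] := gJ x.
rewrite ge0_integralZl_EFin//; last 2 first.
- by move=> x _; rewrite lee_fin addr_ge0// mulr_ge0.
- by apply/measurable_EFinP; exact: measurable_funD.
by rewrite ge0_integralDindic// gr Km.
Qed.

Theorem theorem3p4 (R : realType) (N : nat) (p s : R) (i : 'I_N)
    (u : 'rV[R]_N -> R)
    (hp : 1 < p) (hs0 : 0 < s) (hs1 : s < 1) (hu : is_Ckc 2 u) :
  ((delta `^ (p * (1 - s)))^-1%:E * directional_seminorm s p delta i u)%E
    @[delta --> 0^'+] -->
  ((2 / (p * (1 - s)))%:E *
    'N[lebesgue_rV N]_p%:E[EFin \o partial i u] `^ p)%E.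
Proof.
have p0 : 0 < p by exact: lt_trans hp.
have [K [C [mK Koo C0 vK uK]]] := taylor_powR_estimate i (ltW hp) hu.
have cv : continuous (partial i u) by case: hu => -[_ /(_ i)[_ []]].
have mg : measurable_fun setT (fun x => `|partial i u x| `^ p).
  apply: (measurableT_comp (measurable_powR p)).
  exact: (measurableT_comp (@normr_measurable R setT) (continuous_measurable_rV cv)).
set g := fun x => `|partial i u x| `^ p in mg.
have g0 x : 0 <= g x by exact: powR_ge0.
have Km : lebesgue_rV N K = (fine (lebesgue_rV N K))%:E.
  by rewrite fineK// ge0_fin_numE.
set m := fine _ in Km.
have gI : (\int[lebesgue_rV N]_x (g x)%:E =
    (fine (\int[lebesgue_rV N]_x (g x)%:E))%:E)%E.
  rewrite fineK// ge0_fin_numE; last first.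
    by apply: integral_ge0 => x _; rewrite lee_fin.
  apply: (@le_lt_trans _ _ (\int[lebesgue_rV N]_x (0 + C * \1_K x)%:E)%E).
    apply: ge0_le_integral_nonmeasurable => x _; rewrite lee_fin//.
    by rewrite add0r; exact: vK.
  by rewrite ge0_integralDindic// integral0 add0e lte_mul_pinfty.
set I := fine _ in gI.
rewrite poweR_Lnorm ?gt_eqF//.
have -> : (\int[lebesgue_rV N]_x `|(EFin \o partial i u) x| `^ p)%E = I%:E.
  by rewrite -gI; exact: eq_integral.
rewrite -EFinM.
set a := p * (1 - s).
have bnd (d : R) : 0 < d -> d <= 1 ->
  ((2 / a * (I - C * d * m))%:E <=
    (d `^ a)^-1%:E * directional_seminorm s p d i u <=
    (2 / a * (I + C * d * m))%:E)%E.
  move=> d0 d1.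
  have a0 : 0 < a by rewrite mulr_gt0// subr_gt0.
  have da0 : 0 < d `^ a by rewrite powR_gt0.
  have Cd0 : 0 <= C * d by rewrite mulr_ge0// ltW.
  have k0 : 0 <= 2 / a * d `^ a by rewrite mulr_ge0 ?divr_ge0 ?ltW.
  have := integral_squeeze mK g0 Cd0 k0 mg gI Km.
  move=> /(_ (fun x => \int[lebesgue_measure]_(h in [set h : R | `|h| <= d]%R)
      (`|u (x + h *: evec i) - u x| `^ p / `|h| `^ (1 + s * p))%:E)%E).
  case/(_ _)/andP => [x|lo up].
    apply: integral_difference_quotient_bounds => //.
    - by rewrite mulr_ge0.
    - by rewrite scale0r addr0 subrr.
    move=> h hd; apply: le_trans (uK x h (le_trans hd d1)) _.
    by rewrite ler_wpM2l ?powR_ge0// ler_wpM2r// ler_wpM2l.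
  (* The normalization cancels the power of [d] in the weight. *)
  have kd t : 2 / a * t = (d `^ a)^-1 * (2 / a * d `^ a * t).
    by rewrite [2 / a * d `^ a]mulrC -!mulrA mulKf ?gt_eqF.
  rewrite (kd (I - _)) (kd (I + _)) !(EFinM (d `^ a)^-1).
  by rewrite !lee_pmul2l ?lte_fin ?invr_gt0// lo up.
have lim (e : R) : (2 / a * (I + e * (C * d * m)))%:E @[d --> 0^'+] --> (2 / a * I)%:E.
  apply: cvg_EFin; first exact: nearW.
  have : (fun d : R => 2 / a * (I + e * (C * d * m))) @ 0^'+ -->
      2 / a * (I + e * (C * 0 * m)).
    apply: cvgMl_tmp; apply: cvgD; first exact: cvg_cst.
    apply: cvgMl_tmp; apply: cvgMr_tmp; apply: cvgMl_tmp.
    exact: cvg_at_right_filter.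
  by rewrite mulr0 mul0r mulr0 addr0; exact.
apply: (@squeeze_cvge _ _ _ _ (fun d => (2 / a * (I + -1 * (C * d * m)))%:E) _
  (fun d => (2 / a * (I + 1 * (C * d * m)))%:E)).
- near=> d; rewrite mulN1r mul1r; apply: bnd.
    by near: d; exact: nbhs_right_gt.
  by near: d; exact: nbhs_right_le.
- exact: lim.
- exact: lim.
Unshelve. all: by end_near. Qed.
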